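(* Let $V$ be a finite-dimensional real inner product space, let $M:V\to V$ be a self-adjoint linear operator, and let $V=V^1\oplus\cdots\oplus V^k$ be a (not necessarily orthogonal) direct-sum decomposition. Suppose there are reals $\lambda_1\ge\lambda_2\ge\cdots\ge\lambda_k$ and $c_1,\dots,c_k\ge 0$ such that for every $i$ and every $v_i\in V^i$, \[\|Mv_i-\lambda_i v_i\|\le c_i\|v_i\|.\] If $c_i+c_{i+1}<\lambda_i-\lambda_{i+1}$ for every $1\le i<k$, then \[\mathrm{Spec}(M)\subseteq\bigcup_{i=1}^k[\lambda_i-c_i,\lambda_i+c_i].\]
   Context: A decomposition as in the hypothesis is called a $(\{\lambda_i\},\{c_i\})$-approximate eigendecomposition of $M$. $\mathrm{Spec}(M)$ denotes the set of eigenvalues of $M$. *)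

(* Defs.v *)
From HB Require Import structures.
From mathcomp Require Import all_boot all_order all_algebra.
From mathcomp Require Import boolp classical_sets set_interval reals.

Set Implicit Arguments.
Unset Strict Implicit.
Unset Printing Implicit Defensive.

Import Order.TTheory GRing.Theory Num.Theory.
Local Open Scope ring_scope.

(* A real inner product is a form of type [{dot V for idfun}]: it is bilinear,
   positive definite, and symmetric because the conjugation is [idfun]. *)

Definition dot_norm (R : realType) (V : vectType R) (dot : {dot V for idfun})
    (v : V) : R :=
  Num.sqrt (dot v v).

Definition self_adjoint (R : realType) (V : vectType R)
    (dot : {dot V for idfun}) (M : 'End(V)) : Prop :=
  forall u v : V, dot (M u) v = dot u (M v).

Definition Spec (R : realType) (V : vectType R) (M : 'End(V)) : set R :=
  [set a : R | passmx.leigenvalue M a]%classic.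

(* Main.v *)
(* By the spectral theorem V has an orthogonal basis of eigenvectors of M. For each i, no nonzero
   vector of W i lies in the span of the eigenvectors with eigenvalue outside
   [lambda i - c i, lambda i + c i], as M - lambda i would expand it by a factor larger than c i;
   hence at least dim (W i) basis vectors have their eigenvalue in the i-th interval. The gap
   hypothesis makes the intervals disjoint, and the dimensions of the W i add up to dim V, so
   no basis vector is left for an eigenvalue outside the union. *)
Require Import Defs.
From HB Require Import structures.
From mathcomp Require Import all_boot all_order all_algebra.
From mathcomp Require Import boolp classical_sets set_interval reals.
From mathcomp Require Import complex.
From mathcomp Require Import ring lra.

Set Implicit Arguments.
Unset Strict Implicit.
Unset Printing Implicit Defensive.

Import Order.TTheory GRing.Theory Num.Theory.
Local Open Scope ring_scope.

Section InnerProduct.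

Variables (R : realType) (V : vectType R) (dot : {dot V for idfun}).

Lemma dotC u v : dot u v = dot v u.
Proof. by rewrite hermC expr0 mul1r. Qed.

Lemma dotZl a u v : dot (a *: u) v = a * dot u v.
Proof. exact: linearZl_LR. Qed.

Lemma dotZr a u v : dot u (a *: v) = a * dot u v.
Proof. by rewrite dotC dotZl dotC. Qed.

Lemma dotBl u v w : dot (u - v) w = dot u w - dot v w.
Proof. exact: linearBl. Qed.

Lemma dotDr u v w : dot u (v + w) = dot u v + dot u w.
Proof. exact: linearDr. Qed.

Lemma dot_suml (s : seq V) (F : V -> V) v :
  dot (\sum_(u <- s) F u) v = \sum_(u <- s) dot (F u) v.
Proof. exact: linear_sumlz. Qed.

Lemma dot_sumr (s : seq V) (F : V -> V) v :
  dot v (\sum_(u <- s) F u) = \sum_(u <- s) dot v (F u).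
Proof. exact: linear_sumr. Qed.

Lemma dot_ge0 u : 0 <= dot u u.
Proof.
have [->|/neq0_dnorm_gt0/ltW//] := eqVneq u 0.
by rewrite linear0l.
Qed.

Lemma dot_eq0 u : (dot u u == 0) = (u == 0).
Proof.
have [->|/neq0_dnorm_gt0 u0] := eqVneq u 0; first by rewrite linear0l eqxx.
exact: gt_eqF.
Qed.

(** Orthogonality kills the cross terms, and [uniq s] makes each diagonal term occur once. *)
Lemma dot_sum_orthogonal (s : seq V) (x y : V -> R) :
    uniq s -> {in s &, forall u v, u != v -> dot u v = 0} ->
  dot (\sum_(u <- s) x u *: u) (\sum_(u <- s) y u *: u) =
  \sum_(u <- s) x u * y u * dot u u.
Proof.
move=> s_uniq s_orth; rewrite dot_suml; apply: eq_big_seq => u us.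
rewrite dot_sumr (bigD1_seq u) //= dotZl dotZr mulrA.
rewrite big_seq_cond big1 ?addr0 // => v /andP[vs vu].
by rewrite dotZl dotZr s_orth ?mulr0 // eq_sym.
Qed.

Lemma dot_norm_le_sqr (u v : V) (c : R) : 0 <= c ->
  dot_norm dot u <= c * dot_norm dot v -> dot u u <= c ^+ 2 * dot v v.
Proof.
move=> c0; rewrite /dot_norm => uv.
rewrite -(sqr_sqrtr (dot_ge0 u)) -(sqr_sqrtr (dot_ge0 v)) -exprMn.
by rewrite ler_sqr ?nnegrE ?mulr_ge0 ?sqrtr_ge0.
Qed.

End InnerProduct.

Section Spectral.

Variables (R : realType) (V : vectType R) (dot : {dot V for idfun}).
Variable M : 'End(V).
Hypothesis M_sa : self_adjoint dot M.

(* If x + iy is a complex eigenvector for a + ib, pairing the two real equations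
   crosswise and using self-adjointness gives b (|x|^2 + |y|^2) = 0. *)
Lemma self_adjoint_complex_eigen (a b : R) (x y : V) :
    M x = a *: x - b *: y -> M y = a *: y + b *: x -> (x != 0) || (y != 0) ->
  b = 0.
Proof.
move=> Mx My xy0; have := M_sa x y.
rewrite Mx My dotBl dotDr !dotZl !dotZr => e.
have /eqP : b * (dot x x + dot y y) = 0 by move: e; lra.
rewrite mulf_eq0 => /orP[/eqP//|]; rewrite paddr_eq0 ?dot_ge0 // !dot_eq0.
by rewrite -[_ && _]negbK negb_and xy0.
Qed.

(** The matrix of [M] on [U] has an eigenvector over the complex numbers. Its eigenvalue is real by
    [self_adjoint_complex_eigen], so its real or its imaginary part, whichever is nonzero, is a real
    eigenvector. *)
Lemma self_adjoint_eigenvector (U : {vspace V}) :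
    (M @: U <= U)%VS -> U != 0%VS ->
  exists a, exists2 w, w \in U /\ w != 0 & M w = a *: w.
Proof.
move=> MU U0; pose X := vbasis U.
have XU i : X`_i \in U.
  have [iX|iX] := ltnP i (size X); first by rewrite vbasis_mem ?mem_nth.
  by rewrite nth_default ?mem0v.
pose vec (r : 'rV[R]_(\dim U)) := \sum_j r 0 j *: X`_j.
have vecU r : vec r \in U by apply: memv_suml => j _; rewrite memvZ.
have vec_eq0 r : (vec r == 0) = (r == 0).
  apply/eqP/eqP => [v0|->]; last by apply: big1 => j _; rewrite mxE scale0r.
  have /freeP Xf := basis_free (vbasisP U).
  by apply/rowP => j; rewrite mxE (Xf (fun j => r 0 j)).
(* Row [j] holds the coordinates of the image of the [j]-th basis vector, so [M] acts on row vectors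
   by right multiplication. *)
pose A := \matrix_(j < \dim U, i < \dim U) coord X i (M X`_j).
have M_vec r : M (vec r) = vec (r *m A).
  rewrite linear_sum /=; under eq_bigr => j _.
    rewrite linearZ /= (coord_vbasis (_ : M X`_j \in U)) ?scaler_sumr; last first.
      by rewrite (subvP MU) // memv_img.
    over.
  rewrite exchange_big /=; apply: eq_bigr => i _; rewrite mxE scaler_suml.
  by apply: eq_bigr => j _; rewrite scalerA mxE.
have vecB a b r s : vec (a *: r - b *: s) = a *: vec r - b *: vec s.
  rewrite /vec !scaler_sumr -sumrB; apply: eq_bigr => j _.
  by rewrite !mxE scalerBl !scalerA.
pose C : numClosedFieldType := complex.complex R.
pose inC : R -> C := @complex.real_complex_def R (Phant R).
have dU : (0 < \dim U)%N by rewrite lt0n dimv_eq0.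
have [z /eigenvalueP[q qA q0]] := eigenvalue_closed (map_mx inC A : 'M[C]__) dU.
pose x := vec (map_mx (@complex.Re R) q).
pose y := vec (map_mx (@complex.Im R) q).
(* Since [A] is real, [q *m A = z *: q] splits into the equations for [M x] and [M y]. *)
have ReD : {morph @complex.Re R : u v / (u : C) + (v : C) >-> u + v} by case=> ? ? [].
have ImD : {morph @complex.Im R : u v / (u : C) + (v : C) >-> u + v} by case=> ? ? [].
have ReM u (v : R) : complex.Re ((u : C) * inC v) = complex.Re u * v.
  by case: u => ? ? /=; rewrite mulr0 subr0.
have ImM u (v : R) : complex.Im ((u : C) * inC v) = complex.Im u * v.
  by case: u => ? ? /=; rewrite mulr0 add0r.
have Mx : M x = complex.Re z *: x - complex.Im z *: y.
  rewrite M_vec -vecB; congr vec; apply/rowP => i.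
  have := congr1 (fun r : 'rV[C]__ => complex.Re (r 0 i)) qA.
  rewrite !mxE (big_morph _ ReD (erefl _)).
  case: (q 0 i) z {qA} => ? ? [? ?] /= <-; apply: eq_bigr => j _.
  by rewrite !mxE ReM.
have My : M y = complex.Re z *: y + complex.Im z *: x.
  rewrite M_vec -[_ *: x]opprK -scaleNr -vecB; congr vec; apply/rowP => i.
  have := congr1 (fun r : 'rV[C]__ => complex.Im (r 0 i)) qA.
  rewrite !mxE (big_morph _ ImD (erefl _)) mulNr opprK.
  case: (q 0 i) z {qA Mx} => ? ? [? ?] /= <-; apply: eq_bigr => j _.
  by rewrite !mxE ImM.
have xy0 : (x != 0) || (y != 0).
  rewrite !vec_eq0 -negb_and; apply: contra q0 => /andP[/eqP/rowP r0 /eqP/rowP i0].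
  apply/eqP/rowP => i; move: (r0 i) (i0 i); rewrite !mxE.
  by case: (q 0 i) => /= ? ? -> ->.
have b0 := self_adjoint_complex_eigen Mx My xy0.
by exists (complex.Re z); case/orP: xy0 => [x0|y0]; [exists x | exists y];
  rewrite ?vecU // ?Mx ?My b0 scale0r ?subr0 ?addr0.
Qed.

(** This reads an eigenvalue off its eigenvector, so an eigenbasis can be a bare list of vectors. *)
Definition rayleigh w := dot (M w) w / dot w w.

Lemma rayleigh_eigen a w : w != 0 -> M w = a *: w -> rayleigh w = a.
Proof. by move=> w0 Mw; rewrite /rayleigh Mw dotZl mulfK ?dot_eq0. Qed.

Definition orthogonal_eigenbasis (U : {vspace V}) (s : seq V) :=
  [/\ basis_of U s, {in s &, forall u v, u != v -> dot u v = 0}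
    & {in s, forall w, M w = rayleigh w *: w}].

(** Induction on the dimension: split off an eigenvector [w] and pass to its orthogonal complement
    in [U], which is invariant because [M] is self-adjoint. *)
Lemma self_adjoint_spectral (U : {vspace V}) :
  (M @: U <= U)%VS -> exists s, orthogonal_eigenbasis U s.
Proof.
have [n] := ubnP (\dim U); elim: n U => // n IHn U dU MU.
have [->|U0] := eqVneq U 0%VS.
  by exists [::]; split => //; rewrite basisEdim span_nil subvv dimv0.
have [a [w [wU w0] Mw]] := self_adjoint_eigenvector MU U0.
pose U' := (U :&: orthov dot <[w]>)%VS.
have dimU' : (\dim U').+1 = \dim U.
  rewrite -eq_dim_orthov1 ?prednK ?lt0n ?dimv_eq0 //.
  by apply/mem_orthovPn; exists w => //; rewrite dot_eq0.
have MU' : (M @: U' <= U')%VS.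
  apply/subvP => _ /memv_imgP[v + ->]; rewrite !memv_cap !mem_orthov1.
  case/andP=> vU /eqP vw; rewrite (subvP MU) ?memv_img //=.
  by rewrite M_sa Mw dotZr vw mulr0.
have [|s [sB s_orth s_eig]] := IHn U' _ MU'; first by rewrite -ltnS dimU'.
have sw v : v \in s -> dot v w = 0.
  move=> /(basis_mem sB); rewrite memv_cap mem_orthov1.
  by case/andP=> _ /eqP.
exists (w :: s); split.
(* Here [w] lies outside [U'], the span of [s], because it is not orthogonal to itself; the
   dimension count does the rest. *)
- rewrite basisEfree free_cons (basis_free sB) (span_basis sB) span_cons.
  rewrite (span_basis sB) subv_add -memvE wU capvSl /=.
  rewrite -dimU' (size_basis (X := in_tuple s) sB) leqnn !andbT.
  by rewrite memv_cap mem_orthov1 dot_eq0 (negbTE w0) andbF.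
- move=> u v; rewrite !inE => /orP[/eqP->|us] /orP[/eqP->|vs]; rewrite ?eqxx //.
  + by rewrite dotC sw.
  + by rewrite sw.
  exact: s_orth.
- move=> u; rewrite inE => /orP[/eqP->|/s_eig//].
  by rewrite (rayleigh_eigen w0 Mw).
Qed.

(** Eigenvectors for distinct eigenvalues are orthogonal. If no basis vector had eigenvalue [mu], an
    eigenvector [v] for [mu] would be orthogonal to the whole basis, hence to itself. *)
Lemma leigenvalue_rayleigh (s : seq V) mu :
    orthogonal_eigenbasis fullv s -> passmx.leigenvalue M mu ->
  exists2 w, w \in s & rayleigh w = mu.
Proof.
move=> [sB s_orth s_eig]; rewrite /passmx.leigenvalue -vpick0.
set v := vpick _ => v0.
have Mv : M v = mu *: v.
  have := memv_pick (passmx.leigenspace M mu); rewrite memv_ker -/v.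
  by rewrite add_lfunE opp_lfunE scale_lfunE id_lfunE subr_eq0 => /eqP.
have vw w : w \in s -> rayleigh w != mu -> dot v w = 0.
  move=> ws wmu; have := M_sa v w; rewrite Mv s_eig // dotZl dotZr => /eqP.
  by rewrite -subr_eq0 -mulrBl mulf_eq0 subr_eq0 eq_sym (negbTE wmu) => /eqP.
have [/hasP[w ws /eqP]|/hasPn no] := boolP (has (fun w => rayleigh w == mu) s).
  by exists w.
move: v0; rewrite -(dot_eq0 dot).
have [|x xE _] := free_span (basis_free sB) (v := v).
  by rewrite (span_basis sB) memvf.
rewrite {2}xE dot_sumr big_seq big1 ?eqxx // => w ws.
by rewrite dotZr vw ?mulr0 ?no.
Qed.

Lemma approx_eigenspace_dim (s : seq V) (U : {vspace V}) (l c : R) :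
    orthogonal_eigenbasis fullv s -> 0 <= c ->
    {in U, forall v, dot_norm dot (M v - l *: v) <= c * dot_norm dot v} ->
  (\dim U <= count (fun w => (rayleigh w \in `[l - c, l + c])%R) s)%N.
Proof.
move=> [sB s_orth s_eig] c0 U_approx.
set I := (fun w => _); pose t := filter (predC I) s.
have t_free : free t by rewrite filter_free ?(basis_free sB).
have ts : {subset t <= s} by move=> w; rewrite mem_filter => /andP[].
have Ut0 : (U :&: <<t>> = 0)%VS.
  apply/eqP; rewrite -subv0; apply/subvP => v; rewrite memv_cap memv0.
  case/andP=> vU /(free_span t_free)[x xE _].
  have MvE : M v - l *: v = \sum_(w <- t) x w * (rayleigh w - l) *: w.
    rewrite xE linear_sum scaler_sumr -sumrB; apply: eq_big_seq => w /ts ws.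
    by rewrite /= linearZ /= s_eig // !scalerA -scalerBl mulrBr [l * _]mulrC.
  have t_orth : {in t &, forall u w, u != w -> dot u w = 0}.
    by move=> u w /ts us /ts ws; exact: s_orth.
  have := dot_norm_le_sqr c0 (U_approx v vU).
  rewrite MvE {1 2}xE !dot_sum_orthogonal ?free_uniq // mulr_sumr -subr_le0 -sumrB.
  (* The sum of the [f w] is at most 0 by the approximation bound, while each term is nonnegative on
     [t]; so all terms, and with them the coefficients [x w], vanish. *)
  set f := BIG_F => sum_le0.
  have fP w : w \in t -> 0 <= f w /\ (f w == 0 -> x w = 0).
    rewrite mem_filter /= => /andP[wI ws].
    have w_gt0 : 0 < dot w w.
      by rewrite neq0_dnorm_gt0 // (free_not0 (basis_free sB)).
    (* The factors [rayleigh w - l - c] and [rayleigh w - l + c] have the same strict sign outside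
       the interval, as [c] is nonnegative. *)
    have rc : 0 < (rayleigh w - l) ^+ 2 - c ^+ 2.
      move: wI; rewrite /I in_itv /= negb_and -!ltNge subr_sqr.
      case/orP => ?; nra.
    have -> : f w = x w ^+ 2 * (((rayleigh w - l) ^+ 2 - c ^+ 2) * dot w w).
      by rewrite /f; ring.
    have rc_w := mulr_gt0 rc w_gt0; split; first exact: mulr_ge0 (sqr_ge0 _) (ltW rc_w).
    by rewrite mulf_eq0 sqrf_eq0 (gt_eqF rc_w) orbF => /eqP.
  have /allP f0 : all (fun w => (w \in t) ==> (f w == 0)) t.
    rewrite -psumr_eq0 => [|w /fP[]//]; rewrite -big_seq eq_le sum_le0 /=.
    by rewrite big_seq sumr_ge0 // => w /fP[].
  rewrite xE big_seq big1 // => w wt; have [_ ->] := fP w wt; first by rewrite scale0r.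
  by have := f0 w wt; rewrite wt.
have := dimv_disjoint_sum Ut0; rewrite (eqnP t_free : \dim <<t>> = _).
move=> e; have := dimvS (subvf (U + <<t>>)); rewrite e.
rewrite (size_basis (X := in_tuple s) sB) size_filter -(count_predC I s).
by rewrite leq_add2r.
Qed.

End Spectral.

Theorem theorem3p2 (R : realType) (V : vectType R) (dot : {dot V for idfun})
    (M : 'End(V)) (k : nat) (W : 'I_k -> {vspace V}) (lambda c : 'I_k -> R)
    (M_sa : self_adjoint dot M)
    (W_direct : directv (\sum_(i < k) W i)%VS)
    (W_full : (\sum_(i < k) W i)%VS = {:V}%VS)
    (lambda_ge : forall i j : 'I_k, (i <= j)%N -> lambda j <= lambda i)
    (c_ge0 : forall i : 'I_k, 0 <= c i)
    (M_approx : forall (i : 'I_k) (v : V), v \in W i ->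
       dot_norm dot (M v - lambda i *: v) <= c i * dot_norm dot v)
    (gap : forall i j : 'I_k, j = i.+1 :> nat ->
       c i + c j < lambda i - lambda j) :
  (Spec M `<=` \bigcup_(i : 'I_k) `[lambda i - c i, lambda i + c i])%classic.
Proof.
have sep (i j : 'I_k) : (i < j)%N -> lambda j + c j < lambda i - c i.
  move=> ij; have ik : (i.+1 < k)%N := leq_ltn_trans ij (ltn_ord j).
  have jk : (j.-1 < k)%N := leq_ltn_trans (leq_pred j) (ltn_ord j).
  have j_gt0 : (0 < j)%N := leq_ltn_trans (leq0n i) ij.
  have [ji|ji] := eqVneq (j : nat) i.+1; first by have := gap i j ji; lra.
  have g1 := gap i (Ordinal ik) (erefl _).
  have g2 : _ < _ := gap (Ordinal jk) j (esym (prednK j_gt0)).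
  have g3 : lambda (Ordinal jk) <= lambda (Ordinal ik).
    by apply: lambda_ge => /=; rewrite -ltnS prednK // ltn_neqAle eq_sym ji.
  have := c_ge0 (Ordinal jk); have := c_ge0 (Ordinal ik); lra.
move=> mu mu_eig.
have [s sB] := self_adjoint_spectral M_sa (subvf (M @: fullv)).
have [w0 w0s w0mu] := leigenvalue_rayleigh M_sa sB mu_eig.
pose P i w := rayleigh dot M w \in `[lambda i - c i, lambda i + c i].
have P_disj i j w : P i w -> P j w -> i = j.
  rewrite /P !in_itv /= => /andP[i1 i2] /andP[j1 j2].
  by apply/val_inj; case: (ltngtP i j) => // /sep ij;
    by suff: rayleigh dot M w < rayleigh dot M w; [rewrite ltxx | lra].
have [/existsP[i iw0]|/existsPn no] := boolP [exists i, P i w0].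
  by exists i; rewrite //= -w0mu.
(* Double counting of the pairs [(w, i)] with [P i w]: for fixed [i] there are at least [\dim (W i)]
   of them, and these dimensions add up to that of [V]. *)
have dim_le : (\dim {:V} <= \sum_(w <- s) \sum_(i < k) P i w)%N.
  rewrite -W_full (directvP W_direct) /= exchange_big /=; apply: leq_sum => i _.
  have -> : (\sum_(w <- s) P i w)%N = count (P i) s.
    by rewrite -sum1_count [RHS]big_mkcond; apply: eq_bigr => w _; case: (P i w).
  exact: approx_eigenspace_dim (c_ge0 i) (M_approx i).
have sum_le1 w : (\sum_(i < k) P i w <= 1)%N.
  have [/existsP[i iw]|/existsPn now] := boolP [exists i, P i w]; last first.
    by rewrite big1 // => i _; rewrite (negbTE (now i)).
  rewrite (bigD1 i) //= iw big1 // => j ji.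
  by case: (boolP (P j w)) => // /(P_disj _ _ _ iw) e; rewrite e eqxx in ji.
have [basis_s _ _] := sB.
move: dim_le; rewrite (size_basis (X := in_tuple s) basis_s) leqNgt => /negP[].
(* The vector [w0] contributes 0 and every other basis vector at most 1, so the total falls short of
   [size s]. *)
rewrite (big_rem w0) //= big1 => [|i _]; last by rewrite (negbTE (no i)).
rewrite (perm_size (perm_to_rem w0s)) /= ltnS -sum1_size.
exact: leq_sum.
Qed.
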